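(* Let $R>0$ and let $f:B=B(0,R)\to\mathbb{H}$ be a slice regular function. Then $$\frac{\sqrt2}{2}\,\|f\|\le\|f\|_B\le\|f\|,$$ where $\|f\|_B=\sup_{q\in B}|f(q)|$ and $\|f\|=\sup_{I\in\mathbb{S}}\|f\|_I$.
   Context: $\mathbb{H}$ is the skew field of quaternions; $B(0,R)=\{q\in\mathbb{H}:|q|<R\}$; $\mathbb{S}=\{q\in\mathbb{H}:q^2=-1\}$; for $I\in\mathbb{S}$, $L_I=\mathbb{R}+\mathbb{R}I$ and $B_I=B\cap L_I$. A function $f:B\to\mathbb{H}$ is slice regular if for every $I\in\mathbb{S}$ its restriction $f_I$ to $B_I$ has continuous partial derivatives and satisfies $\frac12\left(\frac{\partial}{\partial x}+I\frac{\partial}{\partial y}\right)f_I(x+yI)=0$ on $B_I$; equivalently, $f(q)=\sum_{n\ge0}q^na_n$ is a convergent power series on $B$ with $a_n\in\mathbb{H}$. For $I\in\mathbb{S}$ and $J\in\mathbb{S}$ orthogonal to $I$ there are unique holomorphic functions $F,G:B_I\to L_I$ with $f_I(z)=F(z)+G(z)J$ for all $z\in B_I$. Set $\|F\|_{B_I}=\sup_{z\in B_I}|F(z)|$, and likewise for $G$, and define $\|f\|_I=\left(\|F\|_{B_I}^2+\|G\|_{B_I}^2\right)^{1/2}$; this does not depend on the choice of $J$. All these quantities take values in $[0,+\infty]$. *)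

(* Defs.v *)
From HB Require Import structures.
From mathcomp Require Import all_boot all_order all_algebra.
From mathcomp Require Import complex ring lra.
From mathcomp Require Import all_classical all_reals all_analysis.

Set Implicit Arguments.
Unset Strict Implicit.
Unset Printing Implicit Defensive.

Import Order.TTheory GRing.Theory Num.Theory.
Import numFieldNormedType.Exports.
Local Open Scope classical_set_scope.
Local Open Scope ring_scope.

Record quat (R : Type) := Quat { qre : R; qi : R; qj : R; qk : R }.

Section QuatAlgebra.
Variable R : realType.
Implicit Types p q : quat R.

Definition quat_tuple q := (qre q, qi q, qj q, qk q).
Definition tuple_quat (t : R * R * R * R) :=
  let: (a, b, c, d) := t in Quat a b c d.

Lemma quat_tupleK : cancel quat_tuple tuple_quat.
Proof. by case. Qed.

HB.instance Definition _ := Choice.copy (quat R) (can_type quat_tupleK).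

Definition quat_add p q :=
  Quat (qre p + qre q) (qi p + qi q) (qj p + qj q) (qk p + qk q).
Definition quat_opp q := Quat (- qre q) (- qi q) (- qj q) (- qk q).
Definition quat_zero : quat R := Quat 0 0 0 0.

Lemma quat_addA : associative quat_add.
Proof. by move=> [????] [????] [????]; rewrite /quat_add /= !addrA. Qed.
Lemma quat_addC : commutative quat_add.
Proof. by move=> p q; congr Quat; rewrite addrC. Qed.
Lemma quat_add0 : left_id quat_zero quat_add.
Proof. by move=> [????]; rewrite /quat_add /= !add0r. Qed.
Lemma quat_addN : left_inverse quat_zero quat_opp quat_add.
Proof. by move=> [????]; rewrite /quat_add /quat_opp /= !addNr. Qed.

HB.instance Definition _ :=
  GRing.isZmodule.Build (quat R) quat_addA quat_addC quat_add0 quat_addN.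

Definition quat_mul p q := Quat
  (qre p * qre q - qi p * qi q - qj p * qj q - qk p * qk q)
  (qre p * qi q + qi p * qre q + qj p * qk q - qk p * qj q)
  (qre p * qj q - qi p * qk q + qj p * qre q + qk p * qi q)
  (qre p * qk q + qi p * qj q - qj p * qi q + qk p * qre q).
Definition quat_one : quat R := Quat 1 0 0 0.

Lemma quat_mulA : associative quat_mul.
Proof. by move=> p q s; rewrite /quat_mul /=; congr Quat; ring. Qed.
Lemma quat_mul1l : left_id quat_one quat_mul.
Proof. by move=> [????]; rewrite /quat_mul /=; congr Quat; ring. Qed.
Lemma quat_mul1r : right_id quat_one quat_mul.
Proof. by move=> [????]; rewrite /quat_mul /=; congr Quat; ring. Qed.
Lemma quat_mulDl : left_distributive quat_mul +%R.
Proof. by move=> [????] [????] [????]; congr Quat; rewrite /=; ring. Qed.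
Lemma quat_mulDr : right_distributive quat_mul +%R.
Proof. by move=> [????] [????] [????]; congr Quat; rewrite /=; ring. Qed.
Lemma quat_one_neq0 : quat_one != 0.
Proof. by apply/eqP => -[/eqP]; rewrite oner_eq0. Qed.

HB.instance Definition _ := GRing.Zmodule_isNzRing.Build (quat R)
  quat_mulA quat_mul1l quat_mul1r quat_mulDl quat_mulDr quat_one_neq0.

Definition quat_scale (a : R) q :=
  Quat (a * qre q) (a * qi q) (a * qj q) (a * qk q).

Lemma quat_scaleA a b q : quat_scale a (quat_scale b q) = quat_scale (a * b) q.
Proof. by rewrite /quat_scale /= !mulrA. Qed.
Lemma quat_scale1 : left_id 1 quat_scale.
Proof. by move=> [????]; rewrite /quat_scale /= !mul1r. Qed.
Lemma quat_scaleDr : right_distributive quat_scale +%R.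
Proof. by move=> a [????] [????]; congr Quat; rewrite /= mulrDr. Qed.
Lemma quat_scaleDl q : {morph quat_scale^~ q : a b / a + b}.
Proof. by move=> a b; congr Quat; rewrite /= mulrDl. Qed.

HB.instance Definition _ := GRing.Zmodule_isLmodule.Build R (quat R)
  quat_scaleA quat_scale1 quat_scaleDr quat_scaleDl.

Lemma quat_scaleAl (a : R) p q : a *: (p * q) = (a *: p) * q.
Proof. by case: p q => [????] [????]; congr Quat; rewrite /=; ring. Qed.

HB.instance Definition _ :=
  GRing.Lmodule_isLalgebra.Build R (quat R) quat_scaleAl.

Lemma quat_scaleAr (a : R) p q : a *: (p * q) = p * (a *: q).
Proof. by case: p q => [????] [????]; congr Quat; rewrite /=; ring. Qed.

HB.instance Definition _ :=
  GRing.Lalgebra_isAlgebra.Build R (quat R) quat_scaleAr.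

Definition quat_dot p q : R :=
  qre p * qre q + qi p * qi q + qj p * qj q + qk p * qk q.
Definition quat_norm q : R := Num.sqrt (quat_dot q q).

Lemma quat_dotxx_ge0 q : 0 <= quat_dot q q.
Proof. by rewrite /quat_dot -!expr2 !addr_ge0 ?sqr_ge0. Qed.

Lemma quat_dot_le p q : quat_dot p q <= quat_norm p * quat_norm q.
Proof.
have [h|/ltW h] := leP (quat_dot p q) 0.
  by rewrite (le_trans h) // mulr_ge0 ?sqrtr_ge0.
rewrite -sqrtrM ?quat_dotxx_ge0 // -(ger0_norm h) -sqrtr_sqr ler_wsqrtr //.
case: p q {h} => [a b c d] [a' b' c' d']; rewrite /quat_dot /=.
rewrite -subr_ge0 (_ : _ - _ =
  (a * b' - b * a') ^+ 2 + (a * c' - c * a') ^+ 2 + (a * d' - d * a') ^+ 2 +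
  (b * c' - c * b') ^+ 2 + (b * d' - d * b') ^+ 2 + (c * d' - d * c') ^+ 2);
  last by ring.
by rewrite !addr_ge0 ?sqr_ge0.
Qed.

Lemma quat_ler_normD p q : quat_norm (p + q) <= quat_norm p + quat_norm q.
Proof.
rewrite -(@ler_pXn2r _ 2) ?nnegrE ?addr_ge0 ?sqrtr_ge0 // sqrrD.
rewrite !sqr_sqrtr ?quat_dotxx_ge0 //.
rewrite (_ : quat_dot (p + q) (p + q) =
          quat_dot p p + quat_dot p q *+ 2 + quat_dot q q).
  by rewrite lerD2r lerD2l lerMn2r quat_dot_le.
by rewrite /quat_dot /=; ring.
Qed.

Lemma quat_normZ (a : R) q : quat_norm (a *: q) = `|a| * quat_norm q.
Proof.
rewrite -sqrtr_sqr -sqrtrM ?sqr_ge0 //; congr Num.sqrt.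
by rewrite /quat_dot /=; ring.
Qed.

Lemma quat_norm0_eq0 q : quat_norm q = 0 -> q = 0.
Proof.
move=> /eqP; rewrite sqrtr_eq0 => h.
have /eqP : quat_dot q q = 0 by apply/le_anti; rewrite h quat_dotxx_ge0.
rewrite /quat_dot -!expr2 !paddr_eq0 ?addr_ge0 ?sqr_ge0 // !sqrf_eq0.
by case: q {h} => [a b c d] /= /andP[/andP[/andP[/eqP-> /eqP->] /eqP->] /eqP->].
Qed.

(* `|q| is the Euclidean norm of R^4, and it generates the topology. *)
HB.instance Definition _ :=
  Lmodule_isNormed.Build R (quat R) quat_ler_normD quat_normZ quat_norm0_eq0.

End QuatAlgebra.

Section SliceRegular.
Variable R : realType.
Implicit Types (I J q : quat R) (r : R) (f F G : quat R -> quat R).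

Definition qball r : set (quat R) := [set q | `|q| < r].

Definition imag_units : set (quat R) := [set q | q ^+ 2 = -1].

(* The identification z = x + yi |-> x + yI of the complex numbers with L_I. *)
Definition to_slice I (z : R[i]) : quat R :=
  (complex.Re z)%:A + complex.Im z *: I.

Definition slice I : set (quat R) := range (to_slice I).

Definition slice_ball r I : set (quat R) := qball r `&` slice I.

Definition slice_restr f I (p : R * R) : quat R := f (p.1%:A + p.2 *: I).

(* A function on B(0, r) is modelled by a total function whose values outside *)
(* the ball are never constrained: the ball is open, so the partial           *)
(* derivatives at its points only depend on the values inside.                *)
Definition slice_regular r f :=
  forall I, imag_units I ->
  forall p : R * R, qball r (p.1%:A + p.2 *: I) ->
  let fI := slice_restr f I in
  [/\ derivable fI p (1, 0) /\ derivable fI p (0, 1),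
      {for p, continuous ('D_(1, 0) fI)} /\ {for p, continuous ('D_(0, 1) fI)}
    & 2^-1 *: ('D_(1, 0) fI p + I * 'D_(0, 1) fI p) = 0].

(* F : B_I -> L_I is holomorphic: read through to_slice I, it is a complex    *)
(* function phi, complex differentiable at every point of the disc.           *)
Definition slice_holomorphic r I F :=
  exists phi : R[i]^o -> R[i]^o, forall z : R[i]^o, qball r (to_slice I z) ->
    derivable phi z 1 /\ F (to_slice I z) = to_slice I (phi z).

Definition splitting r f I J F G :=
  [/\ slice_holomorphic r I F, slice_holomorphic r I G
    & forall z, slice_ball r I z -> f z = F z + G z * J].

Local Open Scope ereal_scope.

Definition sup_norm (A : set (quat R)) f : \bar R :=
  ereal_sup [set `|f q|%:E | q in A].

(* ||f||_I, for slice regular f and I in the sphere of imaginary units: the   *)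
(* set below is then a singleton, and xget picks its element.                 *)
Definition slice_norm_at r f I : \bar R :=
  xget 0 [set v | exists J F G,
    [/\ imag_units J, quat_dot I J = 0%R, splitting r f I J F G
      & v = sqrte (sup_norm (slice_ball r I) F ^+ 2 +
                   sup_norm (slice_ball r I) G ^+ 2)]].

Definition slice_norm r f : \bar R :=
  ereal_sup [set slice_norm_at r f I | I in imag_units].

End SliceRegular.

(* Main.v *)
(* Fix orthogonal units I, J and write f = F + G J on B_I. The basis 1, I, J,
   IJ of H is orthonormal, so |f|^2 = |F|^2 + |G|^2 pointwise on B_I. Hence
   |F|, |G| <= |f|, which gives ||f||_I <= sqrt 2 ||f||_B, and conversely
   |f q| <= ||f||_I for q in B_I, where the B_I cover B. That a splitting
   exists amounts to the pairs (<f, e>, <f, I e>), e = 1, J, satisfying the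
   Cauchy-Riemann equations; continuity of the partial derivatives then makes
   these pairs complex differentiable. *)
Require Import Defs.
From mathcomp Require Import all_boot all_order all_algebra complex ring lra.
From mathcomp Require Import all_classical all_reals all_analysis.

Set Implicit Arguments.
Unset Strict Implicit.
Unset Printing Implicit Defensive.

Import Order.TTheory GRing.Theory Num.Theory.
Import numFieldNormedType.Exports.
Local Open Scope ring_scope.

(** * Total differentials in the plane and the Cauchy-Riemann criterion *)

Section Analysis.
Local Open Scope classical_set_scope.
Context {R : realType}.
Implicit Types (g : R -> R) (a : R * R -> R) (p q : R * R) (x y h k l e d : R).

(** By the mean value theorem the left side is |g' c - l| |y - x| for some c between x and y.
    Letting t range over a ball about x covers both orders of x and y. *)
Lemma mean_value_dist g g' l e x y :
  (forall t, `|t - x| <= `|y - x| -> is_derive t (1 : R) g (g' t)) ->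
  (forall t, `|t - x| <= `|y - x| -> `|g' t - l| <= e) ->
  `|g y - g x - (y - x) * l| <= e * `|y - x|.
Proof.
move=> dg leg.
have mvt s t : s <= t -> (forall c, s <= c <= t -> `|c - x| <= `|y - x|) ->
    exists2 c, `|c - x| <= `|y - x| & g t - g s = g' c * (t - s).
  move=> st sub.
  have [c||c cst ->] := @MVT_segment _ g g' s t st.
  - by rewrite in_itv /= => /andP[/ltW sc /ltW ct]; apply/dg/sub/andP.
  - apply: derivable_within_continuous => c; rewrite in_itv /= => cst.
    by have := dg c (sub c cst) => -[].
  - by exists c => //; apply: sub; rewrite in_itv /= in cst.
have [c cx E] : exists2 c, `|c - x| <= `|y - x| & g y - g x = g' c * (y - x).
  have [xy|/ltW yx] := leP x y.
    apply: mvt => // c /andP[xc cy].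
    by rewrite !ger0_norm ?subr_ge0 // lerD2r.
  have [c /andP[yc cx]|c cx E] := mvt y x yx.
    by rewrite !ler0_norm ?subr_le0 // lerN2 lerD2r.
  by exists c => //; rewrite -opprB E -mulrN opprB.
by rewrite E [_ * l]mulrC -mulrBl normrM ler_wpM2r // leg.
Qed.

Lemma is_derive_fst a p : derivable a p (1, 0) ->
  is_derive p.1 (1 : R) (fun t => a (t, p.2)) ('D_(1, 0) a p).
Proof.
have E : (fun h : R => h^-1 *: ((a \o shift p) (h *: (1, 0)) - a p)) =
  (fun h : R => h^-1 *: (((fun t => a (t, p.2)) \o shift p.1) (h *: 1) -
    a (p.1, p.2))).
  apply: funext => h /=; rewrite -surjective_pairing; do 3!f_equal.
  by apply/eqP; rewrite /= xpair_eqE /= scaler0 add0r ?eqxx.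
by rewrite /derivable /derive E => ?; split.
Qed.

Lemma is_derive_snd a p : derivable a p (0, 1) ->
  is_derive p.2 (1 : R) (fun t => a (p.1, t)) ('D_(0, 1) a p).
Proof.
have E : (fun h : R => h^-1 *: ((a \o shift p) (h *: (0, 1)) - a p)) =
  (fun h : R => h^-1 *: (((fun t => a (p.1, t)) \o shift p.2) (h *: 1) -
    a (p.1, p.2))).
  apply: funext => h /=; rewrite -surjective_pairing; do 3!f_equal.
  by apply/eqP; rewrite /= xpair_eqE /= scaler0 add0r ?eqxx.
by rewrite /derivable /derive E => ?; split.
Qed.

(** Go from p to p + h through the corner (p.1, p.2 + h.2). On each leg only one coordinate varies,
    so [mean_value_dist] applies with the partial derivative at p as l, and the two errors add up to
    the right side. *)
Lemma C1_total_differential a p :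
  (\forall q \near p, derivable a q (1, 0) /\ derivable a q (0, 1)) ->
  {for p, continuous ('D_(1, 0) a)} -> {for p, continuous ('D_(0, 1) a)} ->
  forall e, 0 < e -> \forall h \near (0 : R * R),
    `|a (p + h) - a p - (h.1 * 'D_(1, 0) a p + h.2 * 'D_(0, 1) a p)|
      <= e * (`|h.1| + `|h.2|).
Proof.
move=> da c1 c2 e e0.
have /cvgrPdist_le/(_ e e0) n1 := c1.
have /cvgrPdist_le/(_ e e0) n2 := c2.
have [d /= d0 sub] := (nbhs_ballP _ _).1 (filterI da (filterI n1 n2)).
have near x y : `|p.1 - x| < d -> `|p.2 - y| < d ->
    [/\ derivable a (x, y) (1, 0), derivable a (x, y) (0, 1),
      `|'D_(1, 0) a (x, y) - 'D_(1, 0) a p| <= e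
    & `|'D_(0, 1) a (x, y) - 'D_(0, 1) a p| <= e].
  move=> px py; have [] := sub (x, y); first by split.
  move=> [dx dy] [nx ny]; rewrite distrC in nx; rewrite distrC in ny.
  exact: And4 dx dy nx ny.
apply/nbhs_ballP; exists d => //= -[h k] [].
rewrite /ball /= !sub0r !normrN => hd kd.
have px t : `|t - p.1| <= `|h| -> `|p.1 - t| < d.
  by rewrite distrC => /le_lt_trans; apply.
have py t : `|t - p.2| <= `|k| -> `|p.2 - t| < d.
  by rewrite distrC => /le_lt_trans; apply.
(* This leg lies at height p.2 + k, so its partial derivative is compared with the one at p by joint
   continuity. *)
have D1 : `|a (p.1 + h, p.2 + k) - a (p.1, p.2 + k) - h * 'D_(1, 0) a p|
    <= e * `|h|.
  have py' : `|p.2 - (p.2 + k)| < d by rewrite opprD addNKr normrN.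
  have := @mean_value_dist (fun t => a (t, p.2 + k))
    (fun t => 'D_(1, 0) a (t, p.2 + k)) ('D_(1, 0) a p) e p.1 (p.1 + h).
  rewrite [p.1 + h - p.1]addrAC subrr add0r; apply => t th.
    have [dx _ _ _] := near t (p.2 + k) (px _ th) py'.
    exact: is_derive_fst dx.
  by have [_ _ ? _] := near t (p.2 + k) (px _ th) py'.
have D2 : `|a (p.1, p.2 + k) - a p - k * 'D_(0, 1) a p| <= e * `|k|.
  have px' : `|p.1 - p.1| < d by rewrite subrr normr0.
  have := @mean_value_dist (fun t => a (p.1, t))
    (fun t => 'D_(0, 1) a (p.1, t)) ('D_(0, 1) a p) e p.2 (p.2 + k).
  rewrite [p.2 + k - p.2]addrAC subrr add0r -surjective_pairing; apply => t th.
    have [_ dy _ _] := near p.1 t px' (py _ th).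
    exact: is_derive_snd dy.
  by have [_ _ _ ?] := near p.1 t px' (py _ th).
rewrite mulrDr (le_trans _ (lerD D1 D2)) // (le_trans _ (ler_normD _ _)) //.
by rewrite le_eqVlt; apply/orP; left; apply/eqP; congr `|_|; ring.
Qed.

Lemma normc_le_ReIm (z : R[i]) :
  `|z| <= (`|complex.Re z| + `|complex.Im z|)%:C%C.
Proof.
rewrite normc_def lecR -[leRHS]ger0_norm ?addr_ge0 // -sqrtr_sqr ler_wsqrtr //.
by rewrite sqrrD !real_normK ?num_real // lerD2r lerDl mulrn_wge0 ?mulr_ge0.
Qed.

Lemma normc_ge_ReIm (z : R[i]) :
  (`|complex.Re z|%:C%C <= `|z|) && (`|complex.Im z|%:C%C <= `|z|).
Proof.
by rewrite normc_def !lecR -!sqrtr_sqr !ler_wsqrtr // ?lerDl ?lerDr sqr_ge0.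
Qed.

(** The hypotheses bound the real and imaginary parts of U + iV - h(A + iB). Its modulus is thus at
    most (e/2)(|a| + |b|), hence at most e|h|; dividing by |h| leaves e. *)
Lemma complex_quotient_le (h : R[i]) A B U V e : h != 0 -> 0 <= e ->
  let a := complex.Re h in let b := complex.Im h in
  `|U - (a * A - b * B)| <= e / 4 * (`|a| + `|b|) ->
  `|V - (a * B + b * A)| <= e / 4 * (`|a| + `|b|) ->
  `|Complex A B - h^-1 * Complex U V| <= e%:C%C.
Proof.
move=> h0 e0 a b hU hV; have h1 : 0 < `|h| by rewrite normr_gt0.
have -> : Complex A B - h^-1 * Complex U V =
    - (h^-1 * Complex (U - (a * A - b * B)) (V - (a * B + b * A))).
  apply: (mulfI h0); rewrite mulrBr mulrN !mulrA mulfV // !mul1r.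
  rewrite [X in X * Complex A B](_ : h = Complex a b); last first.
    by rewrite /a /b; case: (h).
  by apply/eqP; rewrite eq_complex /=; apply/andP; split; apply/eqP; ring.
rewrite normrN normrM normfV ler_pdivrMl // (le_trans (normc_le_ReIm _)) //=.
have /andP[ha hb] := normc_ge_ReIm h.
have E : e%:C%C = (e / 2)%:C%C + (e / 2)%:C%C.
  by rewrite -rmorphD /=; congr (_%:C%C); lra.
rewrite E mulrDr (le_trans _ (lerD (ler_wpM2r _ ha) (ler_wpM2r _ hb))) //;
  rewrite ?lecR ?divr_ge0 //.
by rewrite -!rmorphM -rmorphD /= lecR -/a -/b; lra.
Qed.

(** The Cauchy-Riemann equations are built into the hypotheses: the differential of (u, v) at p is
    multiplication by A + iB, which is the complex derivative. *)
Lemma cauchy_riemann_derivable (u v : R * R -> R) p A B :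
  (forall e, 0 < e -> \forall h \near (0 : R * R),
    `|u (p + h) - u p - (h.1 * A - h.2 * B)| <= e * (`|h.1| + `|h.2|)) ->
  (forall e, 0 < e -> \forall h \near (0 : R * R),
    `|v (p + h) - v p - (h.1 * B + h.2 * A)| <= e * (`|h.1| + `|h.2|)) ->
  derivable (fun w : R[i]^o =>
    Complex (u (complex.Re w, complex.Im w)) (v (complex.Re w, complex.Im w))
      : R[i]^o) (Complex p.1 p.2) 1.
Proof.
move=> du dv; apply/cvg_ex; exists (Complex A B); apply/cvgrPdist_le => -[e e'].
(* A positive element of [R[i]] has imaginary part 0, so the tolerance is a positive real. *)
rewrite ltcE /= => /andP[/eqP -> e0]; rewrite {e'}.
have e4 : 0 < e / 4 by rewrite divr_gt0.
have [d /= d0 sub] := nbhs_norm0P.1 (filterI (du _ e4) (dv _ e4)).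
near=> h.
have hd : `|h| < d%:C%C.
  by near: h; apply: (@dnbhs0_lt _ R[i]^o); rewrite ltcR.
have h0 : h != 0 by near: h; exact: (@nbhs_dnbhs_neq R[i]^o).
have /andP[ha hb] := normc_ge_ReIm h.
have : `|(complex.Re h, complex.Im h)| < d.
  by rewrite prod_normE /= gt_max -!ltcR (le_lt_trans ha hd)
    (le_lt_trans hb hd).
have E : h *: 1 + Complex p.1 p.2 =
    Complex (p.1 + complex.Re h) (p.2 + complex.Im h).
  by rewrite /GRing.scale /= mulr1 addrC; case: (h).
case/sub => hu hv; rewrite E /= -surjective_pairing.
have -> (a b c d' : R) :
  Complex a b - Complex c d' = Complex (a - c) (b - d') by [].
exact: complex_quotient_le h0 (ltW e0) hu hv.
Unshelve. all: end_near.
Qed.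

End Analysis.

(** * Imaginary units, slices and the orthogonal splitting of a quaternion *)

Section Quaternions.
Context {R : realType}.
Implicit Types (p q e I J : quat R) (f F G : quat R -> quat R).

Lemma sqr_quat_norm q : `|q| ^+ 2 = quat_dot q q.
Proof. by rewrite sqr_sqrtr ?quat_dotxx_ge0. Qed.

(** The imaginary part of the square is 2a(b, c, d). If a were nonzero, b, c and d would vanish and
    a^2 = -1, which is impossible over the reals. *)
Lemma imag_unitsP I :
  imag_units I <-> qre I = 0 /\ qi I ^+ 2 + qj I ^+ 2 + qk I ^+ 2 = 1.
Proof.
case: I => a b c d /=; split=> [[ea eb ec ed]|[-> E]].
  have a0 : a = 0.
    apply/eqP/negPn/negP => a0.
    have canc (x : R) : a * x + x * a = 0 -> x = 0.
      move=> /eqP; rewrite [x * a]mulrC -mulr2n mulrn_eq0 mulf_eq0.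
      by rewrite (negPf a0) => /eqP.
    have b0 : b = 0 by apply: canc; lra.
    have c0 : c = 0 by apply: canc; lra.
    have d0 : d = 0 by apply: canc; lra.
    have := sqr_ge0 a; rewrite b0 c0 d0 in ea; rewrite expr2; lra.
  by split=> //; rewrite a0 in ea; rewrite !expr2; lra.
by rewrite /imag_units /= expr2; congr Quat => /=; rewrite -?E; ring.
Qed.

Lemma imag_units_normalize q : qre q = 0 -> q != 0 -> imag_units (`|q|^-1 *: q).
Proof.
move=> q0 qn0; apply/imag_unitsP; split; first by rewrite /= q0 mulr0.
rewrite /= !exprMn -!mulrDr exprVn sqr_quat_norm.
have -> : qi q ^+ 2 + qj q ^+ 2 + qk q ^+ 2 = quat_dot q q.
  by rewrite /quat_dot q0 !expr2; ring.
by rewrite mulVf // -sqr_quat_norm expf_neq0 // normr_eq0.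
Qed.

Lemma imag_units_i : imag_units (Quat 0 1 0 0 : quat R).
Proof. by apply/imag_unitsP; split => //=; ring. Qed.

Lemma exists_slice q : exists2 I, imag_units I & slice I q.
Proof.
pose w := q - (qre q)%:A.
have w0 : qre w = 0 by rewrite /w /=; ring.
have E : q = (qre q)%:A + w by rewrite /w addrC subrK.
have [wz|wn0] := eqVneq w 0.
  (* A real q lies in every slice, so any unit serves. *)
  exists (Quat 0 1 0 0); first exact: imag_units_i.
  by exists (Complex (qre q) 0) => //; rewrite /to_slice /= {2}E wz scale0r.
exists (`|w|^-1 *: w); first exact: imag_units_normalize.
exists (Complex (qre q) `|w|) => //.
by rewrite /to_slice /= scalerA mulfV ?normr_eq0 // scale1r -E.
Qed.

Lemma exists_orthogonal I : exists2 J, imag_units J & quat_dot I J = 0.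
Proof.
(* A quarter turn of the (i, j) part of I. If it vanishes, I has no i component and i itself is
   orthogonal to I. *)
pose w := Quat 0 (- qj I) (qi I) 0.
have [wz|wn0] := eqVneq w 0.
  exists (Quat 0 1 0 0); first exact: imag_units_i.
  by case: wz => _ b0; rewrite /quat_dot /= b0; ring.
exists (`|w|^-1 *: w); first exact: imag_units_normalize.
by rewrite /quat_dot /w /=; ring.
Qed.

(** Both sides are the orthogonal projection of p onto L_I: elements of L_I commute with I, those of
    the orthogonal complement anticommute with it, so p -> - I p I is the reflection in L_I. *)
Lemma slice_projE I p : imag_units I ->
  to_slice I (Complex (quat_dot p 1) (quat_dot p I)) =
    2^-1 *: (p - I * p * I).
Proof.
move=> /imag_unitsP; case: I p => a b c d [x y z t] /= [-> E].
(* Multiples of |I|^2 = 1 by each coordinate: given these, the goal is linear in the monomials. *)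
have H (s : R) : s = s * (b ^+ 2 + c ^+ 2 + d ^+ 2) by rewrite E mulr1.
have Hx := H x; have Hy := H y; have Hz := H z; have Ht := H t.
by rewrite /to_slice /quat_dot /=; congr Quat; rewrite /=; lra.
Qed.

Lemma orthogonal_anticomm I J : imag_units I -> imag_units J ->
  quat_dot I J = 0 -> J * I = - (I * J).
Proof.
move=> /imag_unitsP[] + _ /imag_unitsP[] + _.
case: I J => ? b c d [? b' c' d'] /= -> ->; rewrite /quat_dot /= => E.
by congr Quat; rewrite /=; lra.
Qed.

Lemma quat_dot_mulr p q J : imag_units J ->
  quat_dot q (p * J) = quat_dot (- (q * J)) p.
Proof.
move=> /imag_unitsP[+ _]; case: J => ? b c d /= ->.
by rewrite /quat_dot /=; ring.
Qed.

(** With P the projection of [slice_projE], the summands are P(q) and P(-qJ)J. Since JIJ = I, they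
    equal (q - IqI)/2 and (q + IqI)/2. The form [I * 1] matches [slice_holomorphic_component] at e =
    1. *)
Lemma quat_split I J q : imag_units I -> imag_units J -> quat_dot I J = 0 ->
  q = to_slice I (Complex (quat_dot q 1) (quat_dot q (I * 1))) +
      to_slice I (Complex (quat_dot q J) (quat_dot q (I * J))) * J.
Proof.
move=> uI uJ IJ; have JI := orthogonal_anticomm uI uJ IJ.
have JJ : J * J = -1 by rewrite -expr2 uJ.
have -> : quat_dot q J = quat_dot (- (q * J)) 1.
  by rewrite -quat_dot_mulr // mul1r.
rewrite (quat_dot_mulr _ _ uJ) mulr1 !slice_projE // -scalerAl -scalerDr.
have K1 : - (q * J) * J = q by rewrite mulNr -mulrA JJ mulrN mulr1 opprK.
have JIJ : J * (I * J) = I.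
  by rewrite mulrA JI mulNr -mulrA JJ mulrN mulr1 opprK.
have K2 : I * - (q * J) * I * J = - (I * q * I).
  by rewrite mulrN !mulNr -!mulrA JIJ.
rewrite mulrBl K1 K2 opprK addrACA addNr addr0 -mulr2n.
by rewrite -[q *+ 2]scaler_nat scalerA mulVf ?scale1r // pnatr_eq0.
Qed.

(** Right multiplication by the unit J is an isometry, and it carries L_I to a plane orthogonal to
    L_I. *)
Lemma quat_dot_splitting I J (w z : R[i]) : imag_units I -> imag_units J ->
  quat_dot I J = 0 ->
  `|to_slice I w + to_slice I z * J| ^+ 2 =
    `|to_slice I w| ^+ 2 + `|to_slice I z| ^+ 2.
Proof.
move=> /imag_unitsP[+ _] /imag_unitsP[+ E]; rewrite !sqr_quat_norm.
case: I J w z E => ? b c d [? b' c' d'] [x y] [s t] /= E -> ->.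
rewrite /quat_dot /= => IJ.
have {}IJ : b * b' + c * c' + d * d' = 0 by rewrite -IJ; ring.
(* The last term is the cross term, a multiple of the inner product of I and J; the rest is |w|^2 +
   |z|^2 |J|^2, read in the slice. *)
transitivity (x * x + y * y * (b * b + c * c + d * d) +
    (s * s + t * t * (b * b + c * c + d * d)) * (b' ^+ 2 + c' ^+ 2 + d' ^+ 2) +
    2 * (y * s - x * t) * (b * b' + c * c' + d * d')); first by ring.
by rewrite IJ E; ring.
Qed.

End Quaternions.

(** * Holomorphic components of a slice regular function *)

Section Splitting.
Local Open Scope classical_set_scope.
Context {R : realType}.
Implicit Types (p q e I J : quat R) (f F G : quat R -> quat R) (r : R).

Lemma ler_quat_dot p q : `|quat_dot p q| <= `|p| * `|q|.
Proof.
rewrite ler_norml quat_dot_le andbT lerNl.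
have -> : - quat_dot p q = quat_dot (- p) q by rewrite /quat_dot /=; ring.
by rewrite -[`|p|]normrN; exact: quat_dot_le.
Qed.

Lemma quat_dot_mull I p q : imag_units I ->
  quat_dot (I * p) q = - quat_dot p (I * q).
Proof.
move=> /imag_unitsP[+ _]; case: I => ? b c d /= ->.
by rewrite /quat_dot /=; ring.
Qed.

Lemma quat_dot_continuous e : continuous (fun p : quat R => quat_dot p e).
Proof.
move=> p; apply/(@cvgrPdist_le R R (quat R) (nbhs p) _) => eps eps0; near=> q.
have -> : quat_dot p e - quat_dot q e = quat_dot (p - q) e.
  by rewrite /quat_dot /=; ring.
rewrite (le_trans (ler_quat_dot _ _)) //.
(* The +1 keeps the denominator positive when e = 0. *)
rewrite (@le_trans _ _ (eps / (`|e| + 1) * `|e|)) //.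
  rewrite ler_wpM2r //; near: q; apply: cvgr_dist_le; first exact: cvg_id.
  by rewrite divr_gt0 // ltr_wpDl.
by rewrite -mulrA ger_pMr // mulrC ler_pdivrMr ?mul1r ?lerDl // ltr_wpDl.
Unshelve. all: end_near. Qed.

(** The inner product with e is linear and continuous, so it passes through the difference quotient
    and its limit. *)
Lemma is_derive_quat_dot (V : normedModType R) (g : V -> quat R) x v e :
  derivable g x v ->
  is_derive x v (fun y => quat_dot (g y) e) (quat_dot ('D_v g x) e).
Proof.
move=> dg.
have E : (fun h : R => h^-1 *:
      (((fun y => quat_dot (g y) e) \o shift x) (h *: v) - quat_dot (g x) e)) =
    (fun p : quat R => quat_dot p e) \o
      (fun h : R => h^-1 *: ((g \o shift x) (h *: v) - g x)).
  by apply: funext => h /=; rewrite /quat_dot /GRing.scale /=; ring.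
have C := cvg_comp _ _ dg (@quat_dot_continuous e ('D_v g x)).
split.
  by rewrite /derivable E; apply/cvg_ex; exists (quat_dot ('D_v g x) e).
by rewrite /derive E; apply/cvg_lim.
Qed.

Lemma near_qball r I (p : R * R) : qball r (p.1%:A + p.2 *: I) ->
  \forall q \near p, qball r (q.1%:A + q.2 *: I).
Proof.
move=> pr; rewrite /qball /=.
have C : (fun q : R * R => `|q.1%:A + q.2 *: I|) @ p --> `|p.1%:A + p.2 *: I|.
  apply: cvg_norm; apply: cvgD; apply: cvgZr_tmp.
    exact: cvg_fst.
  exact: cvg_snd.
exact: (cvgr_lt _ C _ pr).
Qed.

(** Regularity reads D1 = - I D2, and left multiplication by I is skew-adjoint. For u = <f, e> and v
    = <f, I e> this gives u_x = <D2, I e> = v_y and v_x = <D2, I I e> = - u_y. *)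
Lemma slice_holomorphic_component r f I e :
  slice_regular r f -> imag_units I ->
  slice_holomorphic r I
    (fun q => to_slice I (Complex (quat_dot (f q) e) (quat_dot (f q) (I * e)))).
Proof.
move=> reg uI; pose g e (p : R * R) := quat_dot (slice_restr f I p) e.
exists (fun w => Complex (g e (complex.Re w, complex.Im w))
  (g (I * e) (complex.Re w, complex.Im w))) => -[x y] zr; split; last by [].
have [[d1 d2] [c1 c2] CR] := reg I uI (x, y) zr.
set D1 := 'D_(1, 0) (slice_restr f I) (x, y) in CR.
set D2 := 'D_(0, 1) (slice_restr f I) (x, y) in CR.
have {}CR : D1 = - (I * D2).
  apply/eqP; rewrite -addr_eq0; move/eqP: CR.
  by rewrite scaler_eq0 invr_eq0 pnatr_eq0 /= => /eqP ->.
have nr := near_qball (p := (x, y)) zr.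
have der e' (q : R * R) : qball r (q.1%:A + q.2 *: I) ->
    is_derive q (1, 0) (g e') (quat_dot ('D_(1, 0) (slice_restr f I) q) e') /\
    is_derive q (0, 1) (g e') (quat_dot ('D_(0, 1) (slice_restr f I) q) e').
  move=> qr; have [[q1 q2] _ _] := reg I uI q qr.
  by split; apply: is_derive_quat_dot.
have T e' eps : 0 < eps -> \forall h \near (0 : R * R),
    `|g e' ((x, y) + h) - g e' (x, y) -
      (h.1 * quat_dot D1 e' + h.2 * quat_dot D2 e')| <= eps * (`|h.1| + `|h.2|).
  move=> eps0; have [e1 e2] := der e' (x, y) zr.
  have E1 : 'D_(1, 0) (g e') (x, y) = quat_dot D1 e' :=
    derive_val (is_derive := e1).
  have E2 : 'D_(0, 1) (g e') (x, y) = quat_dot D2 e' :=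
    derive_val (is_derive := e2).
  (* The derivative of the component is known to be the component of the derivative only inside the
     ball; agreement near (x, y) suffices for continuity there. *)
  have cont v : {for (x, y), continuous ('D_v (slice_restr f I))} ->
      (forall q : R * R, qball r (q.1%:A + q.2 *: I) ->
        is_derive q v (g e') (quat_dot ('D_v (slice_restr f I) q) e')) ->
      {for (x, y), continuous ('D_v (g e'))}.
    move=> cv dv; have dv0 := dv (x, y) zr.
    rewrite /prop_for /continuous_at (@derive_val _ _ _ _ _ _ _ dv0).
    have C := cvg_comp _ _ cv (@quat_dot_continuous e' _).
    apply: cvg_trans C; apply: near_eq_cvg.
    apply: filterS nr => q /dv dq; rewrite /= (@derive_val _ _ _ _ _ _ _ dq).
    by [].
  have := @C1_total_differential _ (g e') (x, y); rewrite E1 E2; apply.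
  - apply: filterS nr => q qr; have [q1 q2] := der e' q qr.
    by split; [case: q1 | case: q2].
  - by apply: cont => // q /(der e') [].
  - by apply: cont => // q /(der e') [].
  - exact: eps0.
move: D1 D2 CR T => D1 D2 CR T.
(* The complex derivative is u_x - i u_y. *)
apply: (@cauchy_riemann_derivable _ (g e) (g (I * e)) (x, y)
  (quat_dot D1 e) (- quat_dot D2 e)).
  by move=> eps eps0; apply: filterS (T e eps eps0) => h; rewrite mulrN opprK.
move=> eps eps0; apply: filterS (T (I * e) eps eps0) => h.
suff [-> ->] : quat_dot D1 (I * e) = - quat_dot D2 e /\
    quat_dot D2 (I * e) = quat_dot D1 e
  by exact: id.
have dotN p q : quat_dot (- p) q = - quat_dot p q by rewrite /quat_dot /=; ring.
rewrite CR !dotN !quat_dot_mull // !opprK mulrA -expr2 uI mulN1r; split=> //.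
by rewrite /quat_dot /=; ring.
Qed.

End Splitting.

(** * Comparison of the norms on a single slice *)

Section Norms.
Local Open Scope classical_set_scope.
Local Open Scope ereal_scope.
Context {R : realType}.
Implicit Types (I J q : quat R) (f F G : quat R -> quat R) (r : R).

Lemma sup_norm_ge (A : set (quat R)) f q : A q -> `|f q|%:E <= sup_norm A f.
Proof. by move=> Aq; apply: ereal_sup_ubound; exists q. Qed.

Lemma sup_norm_ge0 (A : set (quat R)) f q : A q -> 0 <= sup_norm A f.
Proof. by move=> Aq; apply: le_trans (sup_norm_ge f Aq); rewrite lee_fin. Qed.

Lemma le_sup_norm (A B : set (quat R)) f F : A `<=` B ->
  (forall q, A q -> (`|F q| <= `|f q|)%R) -> sup_norm A F <= sup_norm B f.
Proof.
move=> AB Ff; apply/ereal_supP => _ [q Aq <-].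
by apply: le_trans (sup_norm_ge f (AB _ Aq)); rewrite lee_fin Ff.
Qed.

Lemma slice_ball0 r I : (0 < r)%R -> slice_ball r I 0%R.
Proof.
move=> r0; split; first by rewrite /qball /= normr0.
by exists (Complex 0 0)%R => //; rewrite /to_slice /= !scale0r addr0.
Qed.

(** The [slice_holomorphic] clauses place F q and G q in L_I, where [quat_dot_splitting] applies. *)
Lemma splitting_norm r f I J F G q : imag_units I -> imag_units J ->
  quat_dot I J = 0%R -> splitting r f I J F G -> slice_ball r I q ->
  (`|f q| ^+ 2 = `|F q| ^+ 2 + `|G q| ^+ 2)%R.
Proof.
move=> uI uJ IJ [[phi hF] [psi hG] E] qI; rewrite (E _ qI).
case: qI => + [z _ zq]; rewrite -zq => zr.
have [_ ->] := hF z zr; have [_ ->] := hG z zr.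
exact: quat_dot_splitting.
Qed.

Lemma exists_splitting r f I : slice_regular r f -> imag_units I ->
  exists J F G, [/\ imag_units J, quat_dot I J = 0%R & splitting r f I J F G].
Proof.
move=> reg uI; have [J uJ IJ] := exists_orthogonal I.
exists J; do 2!eexists; split=> //; split.
- exact: slice_holomorphic_component (1%R : quat R) reg uI.
- exact: slice_holomorphic_component J reg uI.
- by move=> z _; exact: quat_split.
Qed.

Lemma le_slice_norm_at r f I q : slice_regular r f -> imag_units I ->
  slice_ball r I q -> `|f q|%:E <= slice_norm_at r f I.
Proof.
move=> reg uI qI; have [J0 [F0 [G0 [uJ0 IJ0 sp0]]]] := exists_splitting reg uI.
rewrite /slice_norm_at.
(* The bound is proved for whichever splitting [xget] picks; [exists_splitting] rules out the
   default value 0. *)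
case: xgetP => [v _ [J [F [G [uJ IJ sp ->]]]]|noP]; last first.
  exfalso; apply: noP.
  by exists J0, F0, G0; split; [| | exact: sp0 |].
have -> : `|f q|%:E = sqrte (`|F q|%:E ^+ 2 + `|G q|%:E ^+ 2).
  rewrite -!EFin_expe -EFinD -(splitting_norm uI uJ IJ sp qI) EFin_expe.
  by rewrite sqrte_sqr /= normr_id.
have F0q := sup_norm_ge0 F qI; have G0q := sup_norm_ge0 G qI.
rewrite lee_sqrt ?adde_ge0 ?expe_ge0 // leeD // lee_sqr ?lee_fin //;
  exact: sup_norm_ge.
Qed.

Lemma slice_norm_at_le r f I (m : R) : (0 < r)%R -> imag_units I ->
  sup_norm (qball r) f = m%:E -> slice_norm_at r f I <= (Num.sqrt 2 * m)%:E.
Proof.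
move=> r0 uI M; have B0 := slice_ball0 I r0.
have m0 : (0 <= m)%R by rewrite -lee_fin -M; apply: sup_norm_ge0 B0.1.
rewrite /slice_norm_at.
case: xgetP => [v _ [J [F [G [uJ IJ sp ->]]]]|_]; last first.
  (* Here [xget] returns its default 0, below the nonnegative bound. *)
  by rewrite lee_fin mulr_ge0 // sqrtr_ge0.
have FM : sup_norm (slice_ball r I) F <= m%:E.
  rewrite -M; apply: le_sup_norm => [q []//|q qI].
  rewrite -(@ler_pXn2r _ 2) ?nnegrE // (splitting_norm uI uJ IJ sp qI).
  by rewrite lerDl sqr_ge0.
have GM : sup_norm (slice_ball r I) G <= m%:E.
  rewrite -M; apply: le_sup_norm => [q []//|q qI].
  rewrite -(@ler_pXn2r _ 2) ?nnegrE // (splitting_norm uI uJ IJ sp qI).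
  by rewrite lerDr sqr_ge0.
have F0 := sup_norm_ge0 F B0; have G0 := sup_norm_ge0 G B0.
(* Both suprema are at most m, which is where the factor sqrt 2 arises. *)
have -> : (Num.sqrt 2 * m)%:E = sqrte (m%:E ^+ 2 + m%:E ^+ 2).
  have E : (m ^+ 2 + m ^+ 2 = 2 * m ^+ 2)%R by ring.
  rewrite -!EFin_expe -EFinD E /= sqrtrM ?ler0n //.
  by rewrite sqrtr_sqr ger0_norm.
by rewrite lee_sqrt ?adde_ge0 ?expe_ge0 ?lee_fin // leeD // lee_sqr ?lee_fin.
Qed.

End Norms.

(** * Passage from single slices to the whole ball *)

Local Open Scope ereal_scope.

Theorem proposition4p3 (R : realType) (r : R) (r_gt0 : (0 < r)%R)
    (f : quat R -> quat R) (f_reg : slice_regular r f) :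
  (Num.sqrt 2 / 2)%:E * slice_norm r f <= sup_norm (qball r) f /\
  sup_norm (qball r) f <= slice_norm r f.
Proof.
have s2 : (0 < Num.sqrt 2 / 2 :> R)%R by rewrite divr_gt0 // sqrtr_gt0.
split.
  (* An infinite supremum makes the bound trivial, and -oo is excluded because 0 lies in the
     ball. *)
  case M : (sup_norm (qball r) f) => [m||]; last 2 first.
  - by rewrite leey.
  - by have := sup_norm_ge0 f (slice_ball0 0%R r_gt0).1; rewrite M.
  (* Exposes the common positive factor, leaving the slicewise bound sqrt 2 m. *)
  have -> : m = (Num.sqrt 2 / 2 * (Num.sqrt 2 * m))%R.
    have : (Num.sqrt 2 * Num.sqrt 2 = 2 :> R)%R by rewrite -expr2 sqr_sqrtr.
    by move: (Num.sqrt 2) => s /(congr1 ( *%R^~ m)) /= sm; lra.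
  rewrite [leRHS]EFinM lee_pmul2l //.
  by apply/ereal_supP => _ [I uI <-]; apply: slice_norm_at_le.
apply/ereal_supP => _ [q qr <-]; have [I uI qI] := exists_slice q.
apply: le_trans (le_slice_norm_at f_reg uI (conj qr qI)) _.
by apply: ereal_sup_ubound; exists I.
Qed.
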